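(* Let $V$ be a graded vertex coalgebra and let a ($\mathbb{Q}$-graded) vector space $M$ with a linear map $\mathcal{Y}_M(x):M\to(V\otimes M)[[x,x^{-1}]]$ satisfy all the axioms of being a comodule over $V$ except the Jacobi identity, but also satisfy weak cocommutativity: for every $v'\in(V\otimes V\otimes M)'$ there exists $k\in\mathbb{Z}_+$ such that for all $w\in M$ $$(x_1-x_2)^k\langle v',(Id_V\otimes\mathcal{Y}_M(x_2))\mathcal{Y}_M(x_1)w-(T\otimes Id_M)(Id_V\otimes\mathcal{Y}_M(x_1))\mathcal{Y}_M(x_2)w\rangle=0.$$ Let $v'\in(V\otimes V\otimes M)'$ and $w\in M$. (a) (Right rationality) The formal series $\langle v',(Id_V\otimes\mathcal{Y}_M(x_2))\mathcal{Y}_M(x_1)w\rangle$ is in $\mathbb{F}[x_1,x_2^{-1}][[x_1^{-1},x_2]]$ and in fact $$\langle v',(Id_V\otimes\mathcal{Y}_M(x_2))\mathcal{Y}_M(x_1)w\rangle=\iota_{12}f(x_1,x_2)$$ where $f(x_1,x_2)\in\mathbb{F}[x_1,x_2]_S$ is uniquely determined and is of the form $$f(x_1,x_2)=\frac{g(x_1,x_2)}{x_1^rx_2^s(x_1-x_2)^t}$$ for some $g(x_1,x_2)\in\mathbb{F}[x_1,x_2]$ and $r,s,t\in\mathbb{Z}$. (b) (Cocommutativity) It is also the case that $$\iota_{12}^{-1}\langle v',(Id_V\otimes\mathcal{Y}_M(x_2))\mathcal{Y}_M(x_1)w\rangle=\iota_{21}^{-1}\langle v',(T\otimes Id_M)(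Id_V\otimes\mathcal{Y}_M(x_1))\mathcal{Y}_M(x_2)w\rangle.$$
   Context: All vector spaces are over a field $\mathbb{F}$ of characteristic $0$; $x,x_0,x_1,x_2$ are commuting formal variables; $\mathbb{Z}_+$ is the set of positive integers. $\delta(x)=\sum_{n\in\mathbb{Z}}x^n$. For $n\in\mathbb{Z}$, $(x_i\pm x_j)^n$ as a formal series is expanded in nonnegative integral powers of the second listed variable $x_j$ (this also applies inside $\delta$). $W[[x,x^{-1}]]$ is the space of all doubly infinite formal series with coefficients in $W$, and $W((x^{-1}))$ is the space of those with only finitely many positive powers of $x$. $T(u\otimes v)=v\otimes u$ on $V\otimes V$. Linear maps and pairings act on formal series coefficientwise. A vertex coalgebra $(V,\mathcal{Y}_V,c)$ is a vector space $V$ with linear maps $\mathcal{Y}_V(x):V\to(V\otimes V)[[x,x^{-1}]]$ and $c:V\to\mathbb{F}$ such that for all $v\in V$: (left counit) $(c\otimes Id_V)\mathcal{Y}_V(x)v=v$; (cocreation) $(Id_V\otimes c)\mathcal{Y}_V(x)v\in V[[x]]$ and $\lim_{x\to0}(Id_V\otimes c)\mathcal{Y}_V(x)v=v$; (truncation) $\mathcal{Y}_V(x)v\in(V\otimes V)((x^{-1}))$; (Jacobi identity) $$x_0^{-1}\delta\left(\tfrac{x_1-x_2}{x_0}\right)(Id_V\otimes\mathcal{Y}_V(x_2))\mathcal{Y}_V(x_1)-x_0^{-1}\delta\left(\tfrac{x_2-x_1}{-x_0}\right)(T\otimes Id_V)(Id_V\otimes\mathcal{Y}_V(x_1))\mathcal{Y}_V(x_2)=x_2^{-1}\delta\left(\tfrac{x_1-x_0}{x_2}\right)(\mathcal{Y}_V(x_0)\otimes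 Id_V)\mathcal{Y}_V(x_2).$$ It is a graded vertex coalgebra if $V=\coprod_{k\in\mathbb{Z}}V_{(k)}$ is $\mathbb{Z}$-graded with $V_{(k)}=0$ for $k$ sufficiently negative and, writing $\mathcal{Y}_V(x)v=\sum_{k\in\mathbb{Z}}\Delta_k(v)x^{-k-1}$, $\Delta_k(v)\in(V\otimes V)_{(r+k+1)}$ for all $v\in V_{(r)}$, $r,k\in\mathbb{Z}$. The axioms of a comodule $M$ over a graded vertex coalgebra $V$ other than the Jacobi identity are: $M=\coprod_{j\in\mathbb{Q}}M_{(j)}$ is a $\mathbb{Q}$-graded vector space with $M_{(j)}=0$ for $j$ sufficiently negative; writing $\mathcal{Y}_M(x)w=\sum_{k\in\mathbb{Z}}\Delta_k(w)x^{-k-1}$, $\Delta_k(w)\in(V\otimes M)_{(j+k+1)}$ for $w\in M_{(j)}$; and for all $w\in M$: (left counit) $(c\otimes Id_M)\mathcal{Y}_M(x)w=w$; (truncation) $\mathcal{Y}_M(x)w\in(V\otimes M)((x^{-1}))$. For a graded space $W=\coprod_k W_{(k)}$, the graded dual is $W'=\coprod_k\mathrm{Hom}(W_{(k)},\mathbb{F})$, and $\langle\cdot,\cdot\rangle$ is the natural pairing of $W'$ with $W$. Tensor products are graded by total weight. $\mathbb{F}[x_1,x_2]_S$ is the ring of rational functions obtained from $\mathbb{F}[x_1,x_2]$ by inverting products of elements of $S$, the set of nonzero homogeneous linear polynomials in $x_1,x_2$. The injective map $\iota_{12}:\mathbb{F}[x_1,x_2]_S\to\mathbb{F}[[x_1,x_1^{-1},x_2,x_2^{-1}]]$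 expands denominators in nonnegative powers of $x_2$: it sends $\frac{g(x_1,x_2)}{x_1^rx_2^s(x_1-x_2)^t}$ to $\frac{g(x_1,x_2)}{x_1^rx_2^s}$ times the expansion of $(x_1-x_2)^{-t}$ in nonnegative powers of $x_2$. $\iota_{21}$ is defined in the same way with expansion in nonnegative powers of $x_1$. $\iota_{12}^{-1}$ and $\iota_{21}^{-1}$ are the inverses on the images. *)

(* Defs.v *)
From HB Require Import structures.
From mathcomp Require Import all_boot all_order all_algebra.
From mathcomp Require Import sesquilinear ring.
From mathcomp Require Import boolp classical_sets functions cardinality fsbigop.

Set Implicit Arguments.
Unset Strict Implicit.
Unset Printing Implicit Defensive.

Import Order.TTheory GRing.Theory Num.Theory.
Local Open Scope classical_set_scope.
Local Open Scope quotient_scope.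
Local Open Scope ring_scope.

Reserved Notation "A ⊗ B" (at level 40, left associativity).

(** * Tensor products of vector spaces *)

(* An element of V ⊗ W is a formal finite sum of pairs (v, w), two sums being
   identified when every bilinear map out of V x W takes the same value on
   both; [tlift_pure] and [tlift_unique] are the universal property. *)
Section Tensor.
Variables (F : fieldType) (V W : lmodType F).

Definition tsum (U : lmodType F) (b : V -> W -> U) (s : seq (V * W)) : U :=
  \sum_(p <- s) b p.1 p.2.

Definition teq (s t : seq (V * W)) : bool :=
  `[< forall (U : lmodType F) (b : {bilinear V -> W -> U}),
        tsum b s = tsum b t >].

Let teq_refl : reflexive teq. Proof. by move=> s; apply/asboolP. Qed.
Let teq_sym : symmetric teq.
Proof. by move=> s t; apply/asboolP/asboolP => st U b; rewrite st. Qed.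
Let teq_trans : transitive teq.
Proof.
by move=> t s r /asboolP st /asboolP tr; apply/asboolP => U b; rewrite st.
Qed.

Canonical teq_equiv := EquivRel teq teq_refl teq_sym teq_trans.

Definition tensor : Type := {eq_quot teq}.
HB.instance Definition _ : EqQuotient _ teq tensor := EqQuotient.on tensor.
HB.instance Definition _ := Choice.on tensor.

Definition tpure (v : V) (w : W) : tensor := \pi_tensor [:: (v, w)].

Definition tlift (U : lmodType F) (b : {bilinear V -> W -> U}) (x : tensor) : U :=
  tsum b (repr x).

Let tlift_pi (U : lmodType F) (b : {bilinear V -> W -> U}) s :
  tlift b (\pi_tensor s) = tsum b s.
Proof.
suff /asboolP : teq (repr (\pi_tensor s)) s by apply.
by rewrite -[teq _ _](@eqmodE _ teq_equiv); apply/eqP; rewrite reprK.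
Qed.

Let tensor_ext (x y : tensor) :
  (forall (U : lmodType F) (b : {bilinear V -> W -> U}),
     tlift b x = tlift b y) -> x = y.
Proof.
by move=> xy; rewrite -[x]reprK -[y]reprK; apply/eqmodP/asboolP => U b; apply: xy.
Qed.

Definition tadd (x y : tensor) : tensor := \pi_tensor (repr x ++ repr y).
Definition topp (x : tensor) : tensor :=
  \pi_tensor [seq (- p.1, p.2) | p <- repr x].
Definition tscale (a : F) (x : tensor) : tensor :=
  \pi_tensor [seq (a *: p.1, p.2) | p <- repr x].
Definition tzero : tensor := \pi_tensor [::].

Section TliftOp.
Variables (U : lmodType F) (b : {bilinear V -> W -> U}).

Let tliftD x y : tlift b (tadd x y) = tlift b x + tlift b y.
Proof. by rewrite tlift_pi /tsum big_cat. Qed.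
Let tliftN x : tlift b (topp x) = - tlift b x.
Proof.
rewrite tlift_pi /tlift /tsum big_map -sumrN.
by apply: eq_bigr => p _ /=; rewrite linearNl.
Qed.
Let tliftZ a x : tlift b (tscale a x) = a *: tlift b x.
Proof.
rewrite tlift_pi /tlift /tsum big_map scaler_sumr.
by apply: eq_bigr => p _ /=; rewrite linearZl.
Qed.
Let tlift0 : tlift b tzero = 0.
Proof. by rewrite tlift_pi /tsum big_nil. Qed.
Definition tliftE := (tliftD, tliftN, tliftZ, tlift0).
End TliftOp.

Let taddA : associative tadd.
Proof. by move=> x y z; apply: tensor_ext => U b; rewrite !tliftE addrA. Qed.
Let taddC : commutative tadd.
Proof. by move=> x y; apply: tensor_ext => U b; rewrite !tliftE addrC. Qed.
Let tadd0 : left_id tzero tadd.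
Proof. by move=> x; apply: tensor_ext => U b; rewrite !tliftE add0r. Qed.
Let taddN : left_inverse tzero topp tadd.
Proof. by move=> x; apply: tensor_ext => U b; rewrite !tliftE addNr. Qed.

HB.instance Definition _ := GRing.isZmodule.Build tensor taddA taddC tadd0 taddN.

Let tscaleA a b x : tscale a (tscale b x) = tscale (a * b) x.
Proof. by apply: tensor_ext => U f; rewrite !tliftE scalerA. Qed.
Let tscale1 : left_id 1 tscale.
Proof. by move=> x; apply: tensor_ext => U f; rewrite !tliftE scale1r. Qed.
Let tscaleDr : right_distributive tscale +%R.
Proof. by move=> a x y; apply: tensor_ext => U f; rewrite !tliftE scalerDr. Qed.
Let tscaleDl x : {morph tscale^~ x : a b / a + b}.
Proof. by move=> a b; apply: tensor_ext => U f; rewrite !tliftE scalerDl. Qed.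

HB.instance Definition _ :=
  GRing.Zmodule_isLmodule.Build F tensor tscaleA tscale1 tscaleDr tscaleDl.

Let tlift_linear (U : lmodType F) (b : {bilinear V -> W -> U}) :
  linear (tlift b).
Proof. by move=> a x y; rewrite !tliftE. Qed.
HB.instance Definition _ (U : lmodType F) (b : {bilinear V -> W -> U}) :=
  GRing.isLinear.Build F tensor U _ (tlift b) (tlift_linear b).

Lemma tlift_pure (U : lmodType F) (b : {bilinear V -> W -> U}) v w :
  tlift b (tpure v w) = b v w.
Proof. by rewrite tlift_pi /tsum big_seq1. Qed.

Let tpure_bilinear : bilinear_for *:%R *:%R tpure.
Proof.
by split=> [w a v v'|v a w w']; apply: tensor_ext => U f;
  rewrite !tliftE !tlift_pure ?linearPl ?linearPr.
Qed.
HB.instance Definition _ :=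
  bilinear_isBilinear.Build F V W tensor _ _ tpure tpure_bilinear.

Lemma tensor_sum (x : tensor) :
  exists s : seq (V * W), x = \sum_(p <- s) tpure p.1 p.2.
Proof.
exists (repr x); apply: tensor_ext => U b; rewrite raddf_sum.
by apply: eq_bigr => p _; exact/esym/tlift_pure.
Qed.

Lemma tlift_unique (U : lmodType F) (f g : {linear tensor -> U}) :
  (forall v w, f (tpure v w) = g (tpure v w)) -> f =1 g.
Proof.
move=> fg x; have [s ->] := tensor_sum x; rewrite !linear_sum.
by apply: eq_bigr => p _.
Qed.

End Tensor.

Notation "V ⊗ W" := (tensor V W).

Section TensorMaps.
Variables (F : fieldType).
Implicit Types U V W : lmodType F.

Definition tmap_fun V V' W W' (f : {linear V -> V'}) (g : {linear W -> W'})
  (v : V) (w : W) : V' ⊗ W' := tpure (f v) (g w).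
Let tmap_bilinear V V' W W' (f : {linear V -> V'}) (g : {linear W -> W'}) :
  bilinear_for *:%R *:%R (tmap_fun f g).
Proof.
by split=> [w a v v'|v a w w']; rewrite /tmap_fun linearP ?linearPl ?linearPr.
Qed.
HB.instance Definition _ V V' W W' (f : {linear V -> V'}) (g : {linear W -> W'}) :=
  bilinear_isBilinear.Build F V W (V' ⊗ W') _ _ (tmap_fun f g)
    (tmap_bilinear f g).
Definition tmap V V' W W' (f : {linear V -> V'}) (g : {linear W -> W'}) :
  {linear V ⊗ W -> V' ⊗ W'} := tlift (tmap_fun f g).

Definition tswap_fun V W (v : V) (w : W) : W ⊗ V := tpure w v.
Let tswap_bilinear V W : bilinear_for *:%R *:%R (@tswap_fun V W).
Proof.
by split=> [w a v v'|v a w w']; rewrite /tswap_fun ?linearPl ?linearPr.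
Qed.
HB.instance Definition _ V W :=
  bilinear_isBilinear.Build F V W (W ⊗ V) _ _ (@tswap_fun V W)
    (@tswap_bilinear V W).
Definition tswap V W : {linear V ⊗ W -> W ⊗ V} := tlift (@tswap_fun V W).

(* [tscall c] and [tscalr c] are c ⊗ Id and Id ⊗ c followed by the
   identifications F ⊗ W = W and V ⊗ F = V. *)
Definition tscall_fun V W (c : {scalar V}) (v : V) (w : W) : W := c v *: w.
Let tscall_bilinear V W (c : {scalar V}) :
  bilinear_for *:%R *:%R (@tscall_fun V W c).
Proof.
split=> [w a v v'|v a w w']; rewrite /tscall_fun.
  by rewrite /= linearP scalerDl scalerA.
by rewrite /= scalerDr !scalerA mulrC.
Qed.
HB.instance Definition _ V W (c : {scalar V}) :=
  bilinear_isBilinear.Build F V W W _ _ (@tscall_fun V W c)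
    (@tscall_bilinear V W c).
Definition tscall V W (c : {scalar V}) : {linear V ⊗ W -> W} :=
  tlift (@tscall_fun V W c).

Definition tscalr V W (c : {scalar W}) : {linear V ⊗ W -> V} :=
  tscall V c \o tswap V W.

Definition tassoc_fun1 U V W (w : W) (u : U) (v : V) : U ⊗ (V ⊗ W) :=
  tpure u (tpure v w).
Let tassoc_bilinear1 U V W (w : W) :
  bilinear_for *:%R *:%R (@tassoc_fun1 U V W w).
Proof.
split=> [v a u u'|u a v v']; rewrite /tassoc_fun1.
  by rewrite linearPl.
by rewrite (linearPl (@tpure F V W)) (linearPr (@tpure F U (V ⊗ W))).
Qed.
HB.instance Definition _ U V W (w : W) :=
  bilinear_isBilinear.Build F U V (U ⊗ (V ⊗ W)) _ _ (@tassoc_fun1 U V W w)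
    (@tassoc_bilinear1 U V W w).
Definition tassoc_fun U V W (x : U ⊗ V) (w : W) : U ⊗ (V ⊗ W) :=
  tlift (tassoc_fun1 w) x.
Let tassoc_bilinear U V W : bilinear_for *:%R *:%R (@tassoc_fun U V W).
Proof.
split=> [w a x y|x a w w']; rewrite /tassoc_fun; first by rewrite linearP.
have [s ->] := tensor_sum x; rewrite /= !(raddf_sum (tlift _)).
rewrite scaler_sumr -big_split.
apply: eq_bigr => p _ /=; rewrite !tlift_pure /= /tassoc_fun1.
by rewrite (linearPr (@tpure F V W)) (linearPr (@tpure F U (V ⊗ W))).
Qed.
HB.instance Definition _ U V W :=
  bilinear_isBilinear.Build F (U ⊗ V) W (U ⊗ (V ⊗ W)) _ _ (@tassoc_fun U V W)
    (@tassoc_bilinear U V W).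
Definition tassoc U V W : {linear (U ⊗ V) ⊗ W -> U ⊗ (V ⊗ W)} :=
  tlift (@tassoc_fun U V W).

(* T ⊗ Id on U ⊗ (V ⊗ W) = (U ⊗ V) ⊗ W *)
Definition tswap12_fun1 U V W (u : U) (v : V) (w : W) : V ⊗ (U ⊗ W) :=
  tpure v (tpure u w).
Let tswap12_bilinear1 U V W (u : U) :
  bilinear_for *:%R *:%R (@tswap12_fun1 U V W u).
Proof.
split=> [w a v v'|v a w w']; rewrite /tswap12_fun1.
  by rewrite linearPl.
by rewrite (linearPr (@tpure F U W)) (linearPr (@tpure F V (U ⊗ W))).
Qed.
HB.instance Definition _ U V W (u : U) :=
  bilinear_isBilinear.Build F V W (V ⊗ (U ⊗ W)) _ _
    (@tswap12_fun1 U V W u) (@tswap12_bilinear1 U V W u).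
Definition tswap12_fun U V W (u : U) (x : V ⊗ W) : V ⊗ (U ⊗ W) :=
  tlift (tswap12_fun1 u) x.
Let tswap12_bilinear U V W : bilinear_for *:%R *:%R (@tswap12_fun U V W).
Proof.
split=> [x a u u'|u a x y]; rewrite /tswap12_fun; last by rewrite linearP.
have [s ->] := tensor_sum x; rewrite /= !(raddf_sum (tlift _)).
rewrite scaler_sumr -big_split.
apply: eq_bigr => p _ /=; rewrite !tlift_pure /= /tswap12_fun1.
by rewrite (linearPl (@tpure F U W)) (linearPr (@tpure F V (U ⊗ W))).
Qed.
HB.instance Definition _ U V W :=
  bilinear_isBilinear.Build F U (V ⊗ W) (V ⊗ (U ⊗ W)) _ _
    (@tswap12_fun U V W) (@tswap12_bilinear U V W).
Definition tswap12 U V W : {linear U ⊗ (V ⊗ W) -> V ⊗ (U ⊗ W)} :=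
  tlift (@tswap12_fun U V W).

Lemma tmapE V V' W W' (f : {linear V -> V'}) (g : {linear W -> W'}) v w :
  tmap f g (tpure v w) = tpure (f v) (g w).
Proof. exact: tlift_pure. Qed.
Lemma tswapE V W (v : V) (w : W) : tswap V W (tpure v w) = tpure w v.
Proof. exact: tlift_pure. Qed.
Lemma tscallE V W (c : {scalar V}) (v : V) (w : W) :
  tscall W c (tpure v w) = c v *: w.
Proof. exact: tlift_pure. Qed.
Lemma tscalrE V W (c : {scalar W}) (v : V) (w : W) :
  tscalr V c (tpure v w) = c w *: v.
Proof. by rewrite /tscalr /= tswapE tscallE. Qed.
Lemma tassocE U V W (u : U) (v : V) (w : W) :
  tassoc U V W (tpure (tpure u v) w) = tpure u (tpure v w).
Proof. by apply: etrans (tlift_pure _ _ _) _; apply: tlift_pure. Qed.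
Lemma tswap12E U V W (u : U) (v : V) (w : W) :
  tswap12 U V W (tpure u (tpure v w)) = tpure v (tpure u w).
Proof. by apply: etrans (tlift_pure _ _ _) _; apply: tlift_pure. Qed.
End TensorMaps.

(** * Formal series *)

(* A series with coefficients in W is the function sending an exponent to its
   coefficient: W[[x, x^-1]] is [int -> W], and W[[x1, x1^-1, x2, x2^-1]] is
   [int * int -> W], the value at (m, n) being the coefficient of x1^m x2^n. *)
Section Series.
Variable F : fieldType.

(* Cauchy products; the sum over i is 0 if its support is infinite. All the
   products used below have coefficients with finite support: one factor is a
   polynomial, or both are truncated in the same variable (in the Jacobi
   identity, by the truncation axiom). *)
Definition fscale (I : zmodType) (W : lmodType F) (s : I -> F) (t : I -> W) :
    I -> W :=
  fun m => \sum_(i \in [set: I]) (s i *: t (m - i)).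
Definition fmul (I : zmodType) (s t : I -> F) : I -> F :=
  fscale (W := F^o) s t.
Definition fone (I : zmodType) : I -> F := fun i => (i == 0)%:R.

Definition binz (n : int) (i : nat) : F :=
  (\prod_(j < i) (n%:~R - j%:R)) / i`!%:R.

(* (x1 - x2)^n, expanded in nonnegative powers of x2 *)
Definition binexp (n : int) : int * int -> F := fun e =>
  if e.2 is Posz i then
    if e.1 + e.2 == n then (-1) ^+ i * binz n i else 0
  else 0.

(** ** Rational functions *)

(* F[x1, x2] is {poly {poly F}}, with x1 the inner and x2 the outer variable. *)
Definition X1 : {poly {poly F}} := 'X%:P.
Definition X2 : {poly {poly F}} := 'X.

Definition polyser (g : {poly {poly F}}) : int * int -> F := fun e =>
  if e is (Posz i, Posz j) then g`_j`_i else 0.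

(* p.1 x1 + p.2 x2 *)
Definition linform (p : F * F) : {poly {poly F}} :=
  p.1%:P%:P * X1 + p.2%:P%:P * X2.

(* F[x1, x2]_S, inside the field F(x1, x2) *)
Definition ratS : set {fraction {poly {poly F}}} :=
  [set f | exists (g : {poly {poly F}}) (ps : seq (F * F)),
     all (fun p => p != 0) ps /\
     f = tofrac g / tofrac (\prod_(p <- ps) linform p)].

(* (a x1 + b x2)^-1 for p = (a, b), expanded in nonnegative powers of x2:
   the sum of (-b)^i a^(-i-1) x1^(-i-1) x2^i if a != 0, and b^-1 x2^-1 if
   a = 0. *)
Definition linexp12 (p : F * F) : int * int -> F := fun e =>
  if p.1 == 0 then (if e == (0, -1) then p.2^-1 else 0)
  else if e.2 is Posz i then
    (if e.1 == - i%:Z - 1 then (- p.2) ^+ i / p.1 ^+ i.+1 else 0)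
  else 0.
Definition linexp21 (p : F * F) : int * int -> F := fun e =>
  linexp12 (p.2, p.1) (e.2, e.1).

Definition denexp (ex : F * F -> int * int -> F) (ps : seq (F * F)) :
    int * int -> F :=
  foldr (fun p t => fmul (ex p) t) (@fone _) ps.

(* [ex] gives the expansions of the inverses of the elements of S. The series
   does not depend on the fraction that represents f: [iota12E], [iota21E]. *)
Definition iota_series (ex : F * F -> int * int -> F)
    (f : {fraction {poly {poly F}}}) : int * int -> F :=
  xget 0 [set s | exists (g : {poly {poly F}}) (ps : seq (F * F)),
    [/\ all (fun p => p != 0) ps,
        f = tofrac g / tofrac (\prod_(p <- ps) linform p) &
        s = fmul (polyser g) (denexp ex ps)]].
Definition iota12 := iota_series linexp12.
Definition iota21 := iota_series linexp21.

Definition iota12_inv (s : int * int -> F) : {fraction {poly {poly F}}} :=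
  xget 0 [set f | ratS f /\ iota12 f = s].
Definition iota21_inv (s : int * int -> F) : {fraction {poly {poly F}}} :=
  xget 0 [set f | ratS f /\ iota21 f = s].

(* F[x1, x2^-1][[x1^-1, x2]]: finitely many positive powers of x1 and
   finitely many negative powers of x2 *)
Definition right_series (s : int * int -> F) : Prop :=
  exists N : int, forall m n : int, N < m \/ n < - N -> s (m, n) = 0.

End Series.

(** ** Well-definedness and injectivity of the expansion maps *)

Section IotaFacts.
Variable F : fieldType.
Implicit Types (s t : int * int -> F) (g h : {poly {poly F}}) (p : F * F).
Local Notation act g := (fmul (polyser g)).

Lemma fmul_seqE (I : zmodType) (s t : I -> F) m (r : seq I) :
  uniq r -> (forall i, i \notin r -> s i * t (m - i) = 0) ->
  fmul s t m = \sum_(i <- r) s i * t (m - i).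
Proof.
move=> ur r0; rewrite fsbig_seq//; apply/esym; apply: fsbig_widen => // i.
by move=> [_ /= /negP ir]; apply: r0.
Qed.

Lemma fmulr1 (I : zmodType) (s : I -> F) : fmul s (@fone F I) = s.
Proof.
apply/funext => m; rewrite (@fmul_seqE _ _ _ _ [:: m])//.
  by rewrite big_seq1 /fone subrr eqxx mulr1.
move=> i; rewrite inE => im; rewrite /fone subr_eq0 eq_sym.
by rewrite (negbTE im) mulr0.
Qed.

Lemma polyser_actE g s N m : (size g <= N)%N -> (forall j, size (g`_j)%R <= N)%N ->
  act g s m = \sum_(j < N) \sum_(i < N) g`_j`_i * s (m.1 - i%:Z, m.2 - j%:Z).
Proof.
move=> gN gN'.
pose r := [seq (i%:Z, j%:Z) | j <- index_iota 0 N, i <- index_iota 0 N].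
rewrite (@fmul_seqE _ _ _ _ r).
- rewrite big_allpairs_dep big_mkord; apply: eq_bigr => j _.
  by rewrite big_mkord; apply: eq_bigr => i _; case: m.
- by apply: allpairs_uniq; rewrite ?iota_uniq// => -[a b] [c d] _ _ [-> ->].
- move=> [[i|i] [j|j]] //=; rewrite ?mul0r// => ijr.
  have [Ni|iN] := leqP N i.
    by rewrite [_`_i]nth_default ?mul0r// (leq_trans (gN' j)).
  have [Nj|jN] := leqP N j.
    by rewrite [g`_j]nth_default ?(leq_trans gN)// coef0 mul0r.
  case/negP: ijr; apply/allpairsP; exists (j, i) => /=.
  by rewrite !mem_index_iota.
Qed.

Let bound g : exists N0, (size g <= N0)%N /\ forall j, (size (g`_j)%R <= N0)%N.
Proof.
exists (size g + \max_(j < size g) size (g`_j)%R)%N; split; first exact: leq_addr.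
move=> j; have [gj|jg] := leqP (size g) j; first by rewrite nth_default ?size_poly0.
apply: leq_trans (leq_addl _ _).
exact: (@leq_bigmax _ (fun j : 'I_(size g) => size (g`_j)%R) (Ordinal jg)).
Qed.

Let bounds (gs : seq {poly {poly F}}) : exists N0, forall g, g \in gs ->
  (size g <= N0)%N /\ forall j, (size (g`_j)%R <= N0)%N.
Proof.
elim: gs => [|g gs [N1 IH]]; first by exists 0%N.
have [N2 [a b]] := bound g; exists (N1 + N2)%N => h; rewrite inE => /predU1P[->|].
  by split=> [|j]; apply: leq_trans (leq_addl _ _).
by move=> /IH[c d]; split=> [|j]; apply: leq_trans (leq_addr _ _).
Qed.

Lemma polyser_actD g h s m : act (g + h) s m = act g s m + act h s m.
Proof.
have [N bN] := bounds [:: g; h; g + h].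
have [|a1 b1] := bN g; first by rewrite !inE eqxx.
have [|a2 b2] := bN h; first by rewrite !inE eqxx orbT.
have [|a3 b3] := bN (g + h); first by rewrite !inE eqxx !orbT.
rewrite !(@polyser_actE _ _ N)// -big_split; apply: eq_bigr => j _; rewrite -big_split.
by apply: eq_bigr => i _; rewrite !coefD mulrDl.
Qed.

Lemma polyser_actC (d : F) h s m : act (d%:P%:P * h) s m = d * act h s m.
Proof.
have [N bN] := bounds [:: h; d%:P%:P * h].
have [|a1 b1] := bN h; first by rewrite !inE eqxx.
have [|a2 b2] := bN (d%:P%:P * h); first by rewrite !inE eqxx orbT.
rewrite !(@polyser_actE _ _ N)// big_distrr; apply: eq_bigr => j _; rewrite big_distrr.
by apply: eq_bigr => i _; rewrite /= !coefCM mulrA.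
Qed.

Lemma polyser_actX2 h s m : act (h * X2 F) s m = act h s (m.1, m.2 - 1).
Proof.
have [N bN] := bounds [:: h; h * X2 F].
have [|a1 b1] := bN h; first by rewrite !inE eqxx.
have [|a2 b2] := bN (h * X2 F); first by rewrite !inE eqxx orbT.
have a1' := leqW a1; have a2' := leqW a2.
rewrite (@polyser_actE _ _ N.+1)//; try by move=> j; exact: leqW.
rewrite (@polyser_actE h _ N)// big_ord_recl big1 ?add0r; last first.
  by move=> i _; rewrite coefMX coef0 mul0r.
apply: eq_bigr => j _; rewrite big_ord_recr /= coefMX /= add0n.
rewrite [_`_N]nth_default// mul0r addr0; apply: eq_bigr => i _.
by rewrite /= -[in RHS]addrA -opprD -intS.
Qed.

Lemma polyser_actX1 h s m : act (h * X1 F) s m = act h s (m.1 - 1, m.2).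
Proof.
have [N bN] := bounds [:: h; h * X1 F].
have [|a1 b1] := bN h; first by rewrite !inE eqxx.
have [|a2 b2] := bN (h * X1 F); first by rewrite !inE eqxx orbT.
have a1' := leqW a1; have a2' := leqW a2.
rewrite (@polyser_actE _ _ N.+1)//; try by move=> j; exact: leqW.
rewrite (@polyser_actE h _ N)// big_ord_recr /= [X in _ + X]big1 ?addr0; last first.
  by move=> i _; rewrite coefMC [h`_N]nth_default// mul0r coef0 mul0r.
apply: eq_bigr => j _; rewrite big_ord_recl coefMC coefMX mul0r add0r.
by apply: eq_bigr => i _; rewrite coefMX /= add0n -[in RHS]addrA -opprD -intS.
Qed.

Lemma polyser_act0 s m : act 0 s m = 0.
Proof.
rewrite (@polyser_actE _ _ 0) ?big_ord0 ?size_poly0// => j.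
by rewrite coef0 size_poly0.
Qed.

Lemma polyser_act1 s m : act 1 s m = s m.
Proof.
rewrite (@polyser_actE _ _ 1) ?size_poly1//; last first.
  by move=> j; rewrite coef1; case: eqP; rewrite ?size_poly1 ?size_poly0.
by rewrite !big_ord1 !coef1 mul1r !subr0; case: m.
Qed.

Lemma polyser_actM g h s : act (g * h) s = act g (act h s).
Proof.
have outer (c : {poly F}) : act (c%:P * h) s = act c%:P (act h s).
  elim/poly_ind: c => [|c d IH]; apply/funext => m.
    by rewrite mul0r !polyser_act0.
  have -> : (c * 'X + d%:P)%:P = c%:P * X1 F + d%:P%:P by rewrite polyCD polyCM.
  rewrite mulrDl !polyser_actD polyser_actC -[d%:P%:P in RHS]mulr1.
  rewrite polyser_actC polyser_act1; congr (_ + _).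
  by rewrite mulrAC !polyser_actX1 IH.
elim/poly_ind: g => [|g c IH]; apply/funext => m; first by rewrite mul0r !polyser_act0.
by rewrite mulrDl !polyser_actD outer; congr (_ + _); rewrite mulrAC !polyser_actX2 IH.
Qed.

Lemma polyser_actlin p s m :
  act (linform p) s m = p.1 * s (m.1 - 1, m.2) + p.2 * s (m.1, m.2 - 1).
Proof.
rewrite /linform polyser_actD !polyser_actC -[X1 F]mul1r -[X2 F]mul1r.
by rewrite polyser_actX1 polyser_actX2 !polyser_act1.
Qed.

Lemma polyser_inj g h : polyser g = polyser h -> g = h.
Proof.
move=> gh; apply/polyP => j; apply/polyP => i.
exact: (congr1 (fun s => s (Posz i, Posz j)) gh).
Qed.

Lemma linform_coef p : ((linform p)`_1`_0 = p.2) * ((linform p)`_0`_1 = p.1).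
Proof.
split; rewrite /linform /X1 /X2 2!coefD !coefCM coefC [('X : {poly {poly F}})`__]coefX /=.
  by rewrite coef0 coef1 mulr0 add0r mulr1.
by rewrite coefX coef0 mulr0 addr0 mulr1.
Qed.

Section Generic.
Variables (ex : F * F -> int * int -> F) (T : (int * int -> F) -> Prop).
Hypothesis T1 : T (@fone F _).
Hypothesis Tact : forall g s, T s -> T (act g s).
Hypothesis TB : forall s t, T s -> T t -> T (fun m => s m - t m).
Hypothesis Tex : forall p s, p != 0 -> T s -> T (fmul (ex p) s).
Hypothesis exK : forall p s, p != 0 -> T s -> act (linform p) (fmul (ex p) s) = s.
Hypothesis Ttf : forall p s, p != 0 -> T s ->
  (forall m, act (linform p) s m = 0) -> forall m, s m = 0.

Let nz (ps : seq (F * F)) := all (fun p => p != 0) ps.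
Let den ps := \prod_(p <- ps) linform (F := F) p.

Let denexpP ps : nz ps ->
  T (denexp ex ps) /\ act (den ps) (denexp ex ps) = @fone F _.
Proof.
elim: ps => [_|p ps IH /= /andP[p0 /IH[TE DE]]].
  by rewrite /den big_nil; split=> //; apply/funext => m; rewrite polyser_act1.
split; first exact: Tex.
by rewrite /den big_cons mulrC polyser_actM exK.
Qed.

Let act_inj ps s t : nz ps -> T s -> T t -> act (den ps) s = act (den ps) t ->
  s = t.
Proof.
elim: ps s t => [|p ps IH] s t /=.
  rewrite /den big_nil => _ _ _ st; apply/funext => m.
  by rewrite -[LHS]polyser_act1 st polyser_act1.
move=> /andP[p0 ps0] Ts Tt; rewrite /den big_cons mulrC !polyser_actM => st.
have {}st := IH _ _ ps0 (Tact _ Ts) (Tact _ Tt) st.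
apply/funext => m; apply/eqP; rewrite -subr_eq0; apply/eqP.
apply: (Ttf (s := fun m => s m - t m) p0 (TB Ts Tt)) => {}m.
have := congr1 (fun u => u m) st; rewrite !polyser_actlin => e.
rewrite !mulrBr addrACA -opprD; apply/eqP; rewrite subr_eq0; exact/eqP.
Qed.

Let den_neq0 ps : nz ps -> den ps != 0.
Proof.
move=> ps0; rewrite /den prodf_seq_neq0; apply/allP => p pps /=.
have /negP p0 := allP ps0 _ pps; apply/eqP => l0; apply: p0; apply/eqP.
have := congr1 (fun q : {poly {poly F}} => q`_0`_1) l0.
have := congr1 (fun q : {poly {poly F}} => q`_1`_0) l0.
rewrite !coef0 !linform_coef; case: p {l0 pps} => a b /= -> ->.
by [].
Qed.

Let cross g g' ps ps' : nz ps -> nz ps' ->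
  (tofrac g / tofrac (den ps) == tofrac g' / tofrac (den ps')) =
  (g * den ps' == g' * den ps).
Proof.
move=> /den_neq0 d0 /den_neq0 d0'; rewrite eqr_div ?tofrac_eq0//.
by rewrite -!tofracM tofrac_eq.
Qed.

Let series_den g ps : nz ps -> act (den ps) (act g (denexp ex ps)) = polyser g.
Proof.
move=> /denexpP[_ DE]; rewrite -polyser_actM mulrC polyser_actM DE; exact: fmulr1.
Qed.

Let act_polyser g h : act g (polyser h) = polyser (g * h).
Proof. by rewrite -[polyser h]fmulr1 -polyser_actM fmulr1. Qed.

Let series_cross g ps ps' : nz ps -> nz ps' ->
  act (den ps * den ps') (act g (denexp ex ps)) = polyser (g * den ps').
Proof.
by move=> z z'; rewrite mulrC polyser_actM series_den// act_polyser mulrC.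
Qed.

Let den_cat ps ps' : den (ps ++ ps') = den ps * den ps'.
Proof. by rewrite /den big_cat. Qed.

Lemma iota_seriesE g ps : nz ps ->
  iota_series ex (tofrac g / tofrac (den ps)) =
  fmul (polyser g) (denexp ex ps).
Proof.
move=> z; rewrite /iota_series; set P := (X in xget 0 X).
have [] : P (xget 0 P) by apply: xgetPex; exists (act g (denexp ex ps)), g, ps.
move=> g' [ps' [z' /eqP e ->]]; have [TE' _] := denexpP z'.
have [TE _] := denexpP z; apply/esym/(@act_inj (ps ++ ps')).
- by rewrite /nz all_cat; apply/andP.
- exact: Tact.
- exact: Tact.
move: e; rewrite cross// => /eqP e.
by rewrite den_cat series_cross// [den ps * _]mulrC series_cross// e.
Qed.

Lemma iota_series_inj f f' : ratS f -> ratS f' ->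
  iota_series ex f = iota_series ex f' -> f = f'.
Proof.
move=> [g [ps [z ->]]] [g' [ps' [z' ->]]]; rewrite !iota_seriesE// => e.
apply/eqP; rewrite cross//; apply/eqP/polyser_inj.
by rewrite -(series_cross g z z') e [den ps * _]mulrC series_cross.
Qed.
End Generic.

Let T12 s := exists N : int, forall m n : int, n < N -> s (m, n) = 0.

Let lin12_a0 p s m n : p.1 = 0 ->
  fmul (linexp12 p) s (m, n) = p.2^-1 * s (m, n + 1).
Proof.
move=> p0; rewrite (@fmul_seqE _ _ _ _ [:: (0, -1)])//.
  by rewrite big_seq1 /linexp12 p0 !eqxx -[(m, n) - _]/(m - 0, n - - 1) subr0 opprK.
by move=> i; rewrite inE /linexp12 p0 eqxx => /negbTE->; rewrite mul0r.
Qed.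

Let lin12_seq p s (K : nat) (m n : int) : p.1 != 0 ->
  (forall (i : nat) k, (K <= i)%N -> s (k, n - i%:Z) = 0) ->
  fmul (linexp12 p) s (m, n) =
  \sum_(i < K) (- p.2) ^+ i / p.1 ^+ i.+1 * s (m + i%:Z + 1, n - i%:Z).
Proof.
move=> p0 s0; pose r := [seq (- i%:Z - 1, i%:Z) | i <- iota 0 K].
rewrite (@fmul_seqE _ _ _ _ r).
- rewrite big_map -[K in iota 0 K]subn0 big_mkord; apply: eq_bigr => i _.
  rewrite /linexp12 (negbTE p0) /= eqxx; congr (_ * s _).
  rewrite -[(m, n) - _]/(m - (- i%:Z - 1), n - i%:Z).
  by rewrite opprD !opprK addrA.
- by rewrite map_inj_uniq ?iota_uniq// => a b [_].
move=> [a [i|i]] ir; rewrite /linexp12 (negbTE p0) /= ?mul0r//.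
case: eqP => [ai|_]; last by rewrite mul0r.
have [Ki|iK] := leqP K i; first by rewrite [s _]s0 ?mulr0.
by case/negP: ir; apply/mapP; exists i; rewrite ?mem_iota//= -ai.
Qed.

Let lin12_lt s N (n : int) (K : nat) :
  (forall m n : int, n < N -> s (m, n) = 0) -> n < N + K%:Z ->
  forall (i : nat) k, (K <= i)%N -> s (k, n - i%:Z) = 0.
Proof.
by move=> s0 nK i k Ki; apply: s0; rewrite ltrBlDr (lt_le_trans nK)// lerD2l lez_nat.
Qed.

Let T12_1 : T12 (@fone F _).
Proof.
exists 0 => m n n0; rewrite /fone; case: eqP => // -[_ e].
by move: n0; rewrite e ltxx.
Qed.

Let T12_act g s : T12 s -> T12 (act g s).
Proof.
move=> [N s0]; exists N => m n nN; have [K [a b]] := bound g.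
rewrite (@polyser_actE g s K)// big1// => j _; rewrite big1// => i _.
by rewrite s0 ?mulr0//= ltrBlDr (lt_le_trans nN)// lerDl.
Qed.

Let T12_B s t : T12 s -> T12 t -> T12 (fun m => s m - t m).
Proof.
move=> [N s0] [N' t0]; exists (Num.min N N') => m n.
by rewrite lt_min => /andP[? ?]; rewrite s0// t0// subrr.
Qed.

Let T12_ex p s : p != 0 -> T12 s -> T12 (fmul (linexp12 p) s).
Proof.
move=> _ [N s0]; have [p0|p0] := eqVneq p.1 0.
  by exists (N - 1) => m n nN; rewrite lin12_a0// s0 ?mulr0// -ltrBrDr.
exists N => m n nN; rewrite (@lin12_seq p s 0)// ?big_ord0//.
by apply: (lin12_lt s0); rewrite addr0.
Qed.

Let pair_neq0 p : p != 0 -> p.1 = 0 -> p.2 != 0.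
Proof. by case: p => a b; rewrite /= => + a0; rewrite a0; apply: contra_neq => ->. Qed.

Let exK12 p s : p != 0 -> T12 s ->
  act (linform p) (fmul (linexp12 p) s) = s.
Proof.
move=> pn0 [N s0]; apply/funext => -[m n]; rewrite polyser_actlin /=.
have [p0|p0] := eqVneq p.1 0.
  by rewrite !lin12_a0// p0 mul0r add0r mulrA divff ?pair_neq0// mul1r subrK.
have [K nK] : exists K : nat, n < N + K%:Z.
  exists `|n - N|.+1%N; rewrite -ltrBlDl intS [1 + _]addrC ltzD1 abszE.
  exact: ler_norm.
rewrite (@lin12_seq p s K.+1)//; last first.
  by apply: (lin12_lt s0); rewrite intS addrCA (lt_trans nK)// ltrDr.
rewrite (@lin12_seq p s K)//; last first.
  by apply: (lin12_lt s0); rewrite (lt_trans _ nK)// gtrDl.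
rewrite big_ord_recl mulrDr !mulr_sumr -addrA -big_split big1.
  rewrite expr0 mul1r expr1 mulrA divff// mul1r addr0 /=.
  by congr (s (_, _)); [rewrite addr0 subrK | rewrite subr0].
move=> i _; rewrite lift0.
have -> : m - 1 + i.+1%:Z + 1 = m + i%:Z + 1 by rewrite intS; ring.
have -> : n - i.+1%:Z = n - 1 - i%:Z by rewrite intS; ring.
rewrite /= !mulrA -mulrDl [X in X * _](_ : _ = 0) ?mul0r//.
by rewrite !exprS; field; rewrite ?expf_neq0 ?p0.
Qed.

Let Ttf12 p s : p != 0 -> T12 s ->
  (forall m, act (linform p) s m = 0) -> forall m, s m = 0.
Proof.
move=> pn0 [N s0] ls [m n]; have [p0|p0] := eqVneq p.1 0.
  have := ls (m, n + 1); rewrite polyser_actlin p0 mul0r add0r /= addrK => /eqP.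
  by rewrite mulf_eq0 (negbTE (pair_neq0 pn0 p0)) => /eqP.
suff main (k : nat) : forall m n, n < N + k%:Z -> s (m, n) = 0.
  by apply: (main `|n - N|.+1%N); rewrite -ltrBlDl intS [1 + _]addrC ltzD1 abszE;
  exact: ler_norm.
elim: k => [|k IH] {}m {}n; first by rewrite addr0; apply: s0.
rewrite intS addrCA addrC -ltrBlDr => nk.
have := ls (m + 1, n); rewrite polyser_actlin /= addrK.
rewrite [X in _ + _ * X]IH// mulr0 addr0 => /eqP.
by rewrite mulf_eq0 (negbTE p0) => /eqP.
Qed.

Lemma iota12E g ps : all (fun p => p != 0) ps ->
  iota12 (tofrac g / tofrac (\prod_(p <- ps) linform p)) =
  fmul (polyser g) (denexp (@linexp12 F) ps).
Proof. exact: (iota_seriesE T12_1 T12_act T12_B T12_ex exK12 Ttf12). Qed.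

Lemma iota12_inj (f f' : {fraction {poly {poly F}}}) :
  ratS f -> ratS f' -> iota12 f = iota12 f' -> f = f'.
Proof. exact: (iota_series_inj T12_1 T12_act T12_B T12_ex exK12 Ttf12). Qed.

Let sw s : int * int -> F := fun m => s (m.2, m.1).
Let swp p : F * F := (p.2, p.1).
Let T21 s := T12 (sw s).

Let swp_neq0 p : p != 0 -> swp p != 0.
Proof. by case: p => a b; apply: contra_neq => -[-> ->]. Qed.

Let swK s : sw (sw s) = s. Proof. by apply/funext => -[]. Qed.

Let sw_act p s : sw (act (linform p) s) = act (linform (swp p)) (sw s).
Proof. by apply/funext => -[m n]; rewrite /sw !polyser_actlin addrC. Qed.

Let sw_ex p s : sw (fmul (linexp21 p) s) = fmul (linexp12 (swp p)) (sw s).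
Proof.
apply/funext => -[m n]; rewrite /sw /fmul /fscale.
by rewrite (reindex_fsbigT (fun i : int * int => (i.2, i.1)))//;
  exists (fun i => (i.2, i.1)) => -[].
Qed.

Let T21_act g s : T21 s -> T21 (act g s).
Proof.
move=> [N s0]; exists N => m n nN; have [K [a b]] := bound g.
rewrite /sw (@polyser_actE g s K)// big1// => j _; rewrite big1// => i _.
rewrite /= [X in _ * X](_ : _ = sw s (m - j%:Z, n - i%:Z))// s0 ?mulr0//.
by rewrite ltrBlDr (lt_le_trans nN)// lerDl.
Qed.

Let T21_1 : T21 (@fone F _).
Proof.
exists 0 => m n n0; rewrite /sw /fone; case: eqP => // -[e _].
by move: n0; rewrite e ltxx.
Qed.

Let T21_B s t : T21 s -> T21 t -> T21 (fun m => s m - t m).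
Proof. exact: T12_B. Qed.

Let T21_ex p s : p != 0 -> T21 s -> T21 (fmul (linexp21 p) s).
Proof. by move=> p0 Ts; rewrite /T21 sw_ex; apply: T12_ex (swp_neq0 p0) Ts. Qed.

Let exK21 p s : p != 0 -> T21 s ->
  act (linform p) (fmul (linexp21 p) s) = s.
Proof.
move=> p0 Ts; rewrite -[LHS]swK sw_act sw_ex exK12 ?swK//; exact: swp_neq0.
Qed.

Let Ttf21 p s : p != 0 -> T21 s ->
  (forall m, act (linform p) s m = 0) -> forall m, s m = 0.
Proof.
move=> p0 Ts ls [m n]; apply: (Ttf12 (swp_neq0 p0) Ts _ (n, m)) => k.
by rewrite -sw_act; apply: ls.
Qed.

Lemma iota21E g ps : all (fun p => p != 0) ps ->
  iota21 (tofrac g / tofrac (\prod_(p <- ps) linform p)) =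
  fmul (polyser g) (denexp (@linexp21 F) ps).
Proof. exact: (iota_seriesE T21_1 T21_act T21_B T21_ex exK21 Ttf21). Qed.

Lemma iota21_inj (f f' : {fraction {poly {poly F}}}) :
  ratS f -> ratS f' -> iota21 f = iota21 f' -> f = f'.
Proof. exact: (iota_series_inj T21_1 T21_act T21_B T21_ex exK21 Ttf21). Qed.

End IotaFacts.

(** * Gradings and graded duals *)

Section Gradings.
Variable F : fieldType.

(* W is the internal direct sum of the subspaces gr j. *)
Record is_grading (J : choiceType) (W : lmodType F) (gr : J -> set W) : Prop :=
  IsGrading {
    grading0 : forall j, gr j 0;
    gradingP : forall j (a : F) (u v : W), gr j u -> gr j v -> gr j (a *: u + v);
    grading_dec : forall w : W, exists! f : J -> W,
      [/\ forall j, gr j (f j), finite_set [set j | f j <> 0] &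
          w = \sum_(j \in [set: J]) f j] }.

(* total weight on V ⊗ W, for V graded by int and W graded by J = int or rat *)
Definition tgrading (J : pzRingType) (V W : lmodType F)
    (gV : int -> set V) (gW : J -> set W) (k : J) : set (V ⊗ W) :=
  [set x | exists s : seq (V * W),
     (forall p, p \in s -> exists (i : int) (j : J),
        [/\ gV i p.1, gW j p.2 & i%:~R + j = k]) /\
     x = \sum_(p <- s) tpure p.1 p.2].

(* The sum of the Hom(W_(j), F): a family of functionals on the W_(j), almost
   all zero, is the same as a functional on W that is zero on almost all W_(j),
   and the pairing is then evaluation. *)
Record gdual (J : choiceType) (W : lmodType F) (gr : J -> set W) := GDual {
  gdual_val :> {scalar W};
  gdual_fin : exists s : seq J,
    forall j w, j \notin s -> gr j w -> gdual_val w = 0 }.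

Definition pairing (J : choiceType) (W : lmodType F) (gr : J -> set W)
    (I : Type) (w' : gdual gr) (s : I -> W) : I -> F :=
  fun e => w' (s e).

End Gradings.

(** * Vertex coalgebras and comodules *)

Section Coactions.
Variables (F : fieldType) (V M : lmodType F).
Variable Y : {linear M -> (int -> V ⊗ M)}.

Definition ycoef (n : int) (w : M) : V ⊗ M := Y w n.
Let ycoef_linear n : linear (ycoef n).
Proof. by move=> a u v; rewrite /ycoef linearP. Qed.
HB.instance Definition _ n :=
  GRing.isLinear.Build F M (V ⊗ M) _ (ycoef n) (ycoef_linear n).

(* Y(x) w is the sum of the Delta_k(w) x^(-k-1). *)
Definition ydelta (k : int) (w : M) : V ⊗ M := Y w (- k - 1).

(* (Id ⊗ Y(x2)) Y(x1) w *)
Definition yy12 (w : M) : int * int -> V ⊗ (V ⊗ M) :=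
  fun e => tmap idfun (ycoef e.2) (Y w e.1).
(* (T ⊗ Id) (Id ⊗ Y(x1)) Y(x2) w *)
Definition yy21 (w : M) : int * int -> V ⊗ (V ⊗ M) :=
  fun e => tswap12 V V M (tmap idfun (ycoef e.1) (Y w e.2)).

Definition left_counit (c : {scalar V}) : Prop :=
  forall w n, tscall M c (Y w n) = if n == 0 then w else 0.

Definition truncated : Prop :=
  forall w, exists N : int, forall n, N < n -> Y w n = 0.

Definition graded_coaction (J : pzRingType) (gV : int -> set V)
    (gM : J -> set M) : Prop :=
  forall j w, gM j w ->
    forall k : int, tgrading gV gM (j + k%:~R + 1) (ydelta k w).

End Coactions.

Section VertexCoalgebra.
Variables (F : fieldType) (V : lmodType F).
Variables (Y : {linear V -> (int -> V ⊗ V)}) (c : {scalar V}).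

Definition cocreation : Prop :=
  forall v, (forall n, n < 0 -> tscalr V c (Y v n) = 0) /\
            tscalr V c (Y v 0) = v.

(* (Y(x0) ⊗ Id) Y(x2) v, at the exponent of x0 and the exponent of x2 *)
Definition yy02 (v : V) (e0 e2 : int) : V ⊗ (V ⊗ V) :=
  tassoc V V V (tmap (ycoef Y e0) idfun (Y v e2)).

(* Series in x0, x1, x2 are indexed by (e0, e1, e2). The delta series are
   x0^-1 delta((x1 - x2) / x0) = sum_n x0^(-n-1) (x1 - x2)^n,
   x0^-1 delta((x2 - x1) / (- x0)) = sum_n (-1)^n x0^(-n-1) (x2 - x1)^n,
   x2^-1 delta((x1 - x0) / x2) = sum_n x2^(-n-1) (x1 - x0)^n. *)
Definition delta_x1x2_x0 (e : int * int * int) : F :=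
  let: (e0, e1, e2) := e in binexp F (- e0 - 1) (e1, e2).
Definition delta_x2x1_x0 (e : int * int * int) : F :=
  let: (e0, e1, e2) := e in (-1) ^ (- e0 - 1) * binexp F (- e0 - 1) (e2, e1).
Definition delta_x1x0_x2 (e : int * int * int) : F :=
  let: (e0, e1, e2) := e in binexp F (- e2 - 1) (e1, e0).

Definition jacobi_identity : Prop :=
  forall v (m : int * int * int),
    fscale delta_x1x2_x0
      (fun e => let: (e0, e1, e2) := e in
                if e0 == 0 then yy12 Y v (e1, e2) else 0) m
    - fscale delta_x2x1_x0
      (fun e => let: (e0, e1, e2) := e in
                if e0 == 0 then yy21 Y v (e1, e2) else 0) m
    = fscale delta_x1x0_x2
      (fun e => let: (e0, e1, e2) := e in
                if e1 == 0 then yy02 v e0 e2 else 0) m.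

Record vertex_coalgebra : Prop := VertexCoalgebra {
  vc_counit : left_counit Y c;
  vc_cocreation : cocreation;
  vc_truncation : truncated Y;
  vc_jacobi : jacobi_identity }.

Record graded_vertex_coalgebra (gV : int -> set V) : Prop :=
  GradedVertexCoalgebra {
    gvc_vc : vertex_coalgebra;
    gvc_grading : is_grading gV;
    gvc_bounded : exists N : int, forall k v, k < N -> gV k v -> v = 0;
    gvc_graded : graded_coaction Y gV gV }.

End VertexCoalgebra.

Record comodule_except_jacobi (F : fieldType) (V M : lmodType F)
    (gV : int -> set V) (c : {scalar V}) (gM : rat -> set M)
    (Y : {linear M -> (int -> V ⊗ M)}) : Prop := ComoduleExceptJacobi {
  com_grading : is_grading gM;
  com_bounded : exists N : rat, forall j w, j < N -> gM j w -> w = 0;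
  com_graded : graded_coaction Y gV gM;
  com_counit : left_counit Y c;
  com_truncation : truncated Y }.

Definition weak_cocommutativity (F : fieldType) (V M : lmodType F)
    (gV : int -> set V) (gM : rat -> set M)
    (Y : {linear M -> (int -> V ⊗ M)}) : Prop :=
  forall v' : gdual (tgrading gV (tgrading gV gM)),
  exists k : nat, (0 < k)%N /\
    forall (w : M) (e : int * int),
      fmul (binexp F k%:Z) (pairing v' (fun i => yy12 Y w i - yy21 Y w i)) e = 0.

(* Main.v *)
Require Import Defs.
From HB Require Import structures.
From mathcomp Require Import all_boot all_order all_algebra.
From mathcomp Require Import ring zify.
From mathcomp Require Import boolp classical_sets functions fsbigop.

Import Order.TTheory GRing.Theory Num.Theory.
Local Open Scope classical_set_scope.
Local Open Scope ring_scope.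

Set Implicit Arguments.
Unset Strict Implicit.
Unset Printing Implicit Defensive.

(** Write s(x1, x2) and u(x1, x2) for the pairings of v' with the iterated
    coaction (Id ⊗ Y(x2)) Y(x1) w and with its transpose
    (T ⊗ Id) (Id ⊗ Y(x1)) Y(x2) w.  Everything follows from the shape of their
    supports.

    Truncation of the coaction that is applied first bounds the exponent of x1 in s, and the
    exponent of x2 in u, from above.  The coefficient of x1^m x2^n has weight
    j - (m + n) when w has weight j, and v' sees only finitely many weights, so
    in both series m + n is bounded from below ([pairing_bounded]).  Hence n is
    bounded from below in s, and m in u: these are the regions in which the
    expansions of rational functions by iota_12 and iota_21 live.

    By weak cocommutativity (x1 - x2)^k s = (x1 - x2)^k u.  Multiplication by a
    polynomial preserves the three bounds, so this common series has exponents of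
    x1 and of x2 bounded from above and total degree bounded from below.  Its
    support is therefore finite, that is, it is a Laurent polynomial
    g / (x1 x2)^A, and f = g / ((x1 x2)^A (x1 - x2)^k) is the only candidate for
    the rational function.

    It remains to divide s and u by the denominator ([expansion_unique]).  A nonzero linear form that kills a series makes its
    coefficients geometric along each antidiagonal m + n = constant; if they
    vanish far out in one direction they vanish everywhere
    ([linform_act_inj]).  So in each of the two regions division by linear forms
    is unique, and the expansions of f in the two regions are s and u
    ([common_rational_function]). *)

(** * Supports of series bounded in a direction *)

Section SeriesSupport.
Variable F : fieldType.
Implicit Types (s t : int * int -> F) (g : {poly {poly F}}) (p : F * F).

(** The values of a m + b n on the exponents (m, n) of s are bounded from below.
    Letting (a, b) vary covers lower and upper bounds on each exponent as well as
    on the total degree. *)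
Definition bounded_below (a b : int) s : Prop :=
  exists N : int, forall m n : int, a * m + b * n < N -> s (m, n) = 0.

(** If every factorization (i, j) + (m - i, n - j) of an exponent has a factor
    outside the support, the Cauchy product vanishes term by term, even where the
    sum that defines it has infinitely many indices. *)
Lemma bounded_belowM a b s t :
  bounded_below a b s -> bounded_below a b t -> bounded_below a b (fmul s t).
Proof.
move=> [N s0] [N' t0]; exists (N + N') => m n mnN.
apply: fsbig1 => -[i j] _; rewrite -[(m, n) - _]/(m - i, n - j).
have [ijN|Nij] := ltP (a * i + b * j) N; first by rewrite s0// scale0r.
rewrite t0 ?scaler0//; have -> : a * (m - i) + b * (n - j) =
  a * m + b * n - (a * i + b * j) by ring.
lia.
Qed.

Lemma bounded_belowB a b s t : bounded_below a b s -> bounded_below a b t ->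
  bounded_below a b (fun e => s e - t e).
Proof.
move=> [N s0] [N' t0]; exists (Num.min N N') => m n.
by rewrite lt_min => /andP[? ?]; rewrite s0// t0// subrr.
Qed.

Lemma bounded_below_polyser a b g : bounded_below a b (polyser g).
Proof.
pose r := flatten [seq [seq (i, j) | i <- iota 0 (size (g`_j))]
                  | j <- iota 0 (size g)].
exists (- \sum_(e <- r) `|a * e.1%:Z + b * e.2%:Z|) => -[i|i] [j|j] //= ltN.
have [gj|jg] := leqP (size g) j; first by rewrite [g`_j]nth_default// coef0.
have [gi|ig] := leqP (size g`_j) i; first by rewrite nth_default.
have ijr : (i, j) \in r.
  apply/flatten_mapP; exists j; rewrite ?mem_iota//.
  by apply/mapP; exists i; rewrite ?mem_iota.
move: ltN; rewrite (big_rem _ ijr) /= ltNge => /negP[].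
rewrite lerNl (le_trans (ler_norm _))// normrN lerDl.
exact: sumr_ge0.
Qed.

Lemma bounded_below_denexp a b (ex : F * F -> int * int -> F) ps :
  (forall p, bounded_below a b (ex p)) -> bounded_below a b (denexp ex ps).
Proof.
move=> bex; elim: ps => [|p ps IH] /=; last exact: bounded_belowM.
exists 0 => m n; rewrite /fone; case: eqP => // -[-> ->].
by rewrite !mulr0 addr0 ltxx.
Qed.

Lemma bounded_below_linexp12 p : bounded_below 0 1 (linexp12 p).
Proof.
exists (- 1) => m [n|n] /=; rewrite mul0r add0r mul1r /linexp12 /=; first lia.
by case: ifP => // _; case: eqP => // -[]; lia.
Qed.

Lemma bounded_below_linexp21 p : bounded_below 1 0 (linexp21 p).
Proof.
have [N l0] := bounded_below_linexp12 (p.2, p.1).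
by exists N => m n mN; apply: l0; rewrite addrC.
Qed.

(** * Uniqueness of division by linear forms *)

(** The condition a != b says that a m + b n tends to minus infinity along each
    antidiagonal m + n = constant, in one of its two directions.  When both
    coefficients of the form are nonzero, neighbouring coefficients of s on the
    antidiagonal are proportional with a nonzero ratio, so a single zero forces
    the whole antidiagonal to vanish. *)
Lemma linform_act_inj (a b : int) p s : a != b ->
  p != 0 -> bounded_below a b s ->
  fmul (polyser (linform p)) s = (fun=> 0) -> s = (fun=> 0).
Proof.
move=> ab p0 [N s0] ls; apply/funext => -[m n].
have rec i j : p.1 * s (i - 1, j) + p.2 * s (i, j - 1) = 0.
  by rewrite -[RHS](congr1 (fun u => u (i, j)) ls) polyser_actlin.
have [p1|p1] := eqVneq p.1 0.
  have p2 : p.2 != 0 by move: p0 p1; case: (p) => c d /= + c0; rewrite c0;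
    apply: contra_neq => ->.
  have := rec m (n + 1); rewrite p1 mul0r add0r addrK => /eqP.
  by rewrite mulf_eq0 (negbTE p2) => /eqP.
have [p2|p2] := eqVneq p.2 0.
  have := rec (m + 1) n; rewrite p2 mul0r addr0 addrK => /eqP.
  by rewrite mulf_eq0 (negbTE p1) => /eqP.
have step i j : (s (i, j) == 0) = (s (i + 1, j - 1) == 0).
  have := rec (i + 1) j; rewrite addrK => /eqP.
  rewrite addr_eq0 => /eqP e; have := congr1 (fun x => x == 0) e.
  by rewrite oppr_eq0 !mulf_eq0 (negbTE p1) (negbTE p2).
have steps (k : nat) i j : (s (i, j) == 0) = (s (i + k%:Z, j - k%:Z) == 0).
  elim: k i j => [|k IH] i j; first by rewrite addr0 subr0.
  by rewrite step IH intS; congr (s (_, _) == 0); ring.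
pose k := `|(a * m + b * n - N)%R|%N.+1; apply/eqP.
have [ba|ab'|/eqP] := ltgtP b a; last by rewrite eq_sym (negbTE ab).
  (* walk along the antidiagonal until a m + b n drops below N *)
  rewrite -[m](subrK k%:Z) -[n](addrK k%:Z) -steps s0//.
  have -> : a * (m - k%:Z) + b * (n + k%:Z) =
    a * m + b * n - (a - b) * k%:Z by ring.
  by have : k%:Z <= (a - b) * k%:Z; [rewrite ler_peMl//; lia | lia].
rewrite (steps k) s0//.
have -> : a * (m + k%:Z) + b * (n - k%:Z) =
  a * m + b * n - (b - a) * k%:Z by ring.
by have : k%:Z <= (b - a) * k%:Z; [rewrite ler_peMl//; lia | lia].
Qed.

Lemma linforms_act_inj (a b : int) (ps : seq (F * F)) s : a != b ->
  all (fun p => p != 0) ps -> bounded_below a b s ->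
  fmul (polyser (\prod_(p <- ps) linform p)) s = (fun=> 0) -> s = (fun=> 0).
Proof.
move=> ab; elim: ps s => [|p ps IH] s /=.
  by move=> _ _; rewrite big_nil => e; apply/funext => m; rewrite -[LHS]polyser_act1 e.
move=> /andP[p0 ps0] bs; rewrite big_cons mulrC polyser_actM.
move=> /IH e; apply: (linform_act_inj ab p0 bs); apply: e => //.
by apply: bounded_belowM => //; apply: bounded_below_polyser.
Qed.

Lemma polyser_actB g s t : fmul (polyser g) (fun e => s e - t e) =
  (fun e => fmul (polyser g) s e - fmul (polyser g) t e).
Proof.
apply/funext => e.
have [N [gN gN']] : exists N, (size g <= N)%N /\ forall j, (size (g`_j)%R <= N)%N.
  exists (size g + \max_(j < size g) size (g`_j)%R)%N; split; first exact: leq_addr.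
  move=> j; have [gj|jg] := leqP (size g) j; first by rewrite nth_default ?size_poly0.
  apply: leq_trans (leq_addl _ _).
  exact: (@leq_bigmax _ (fun j : 'I_(size g) => size (g`_j)%R) (Ordinal jg)).
rewrite !(polyser_actE _ _ gN gN') -sumrB; apply: eq_bigr => j _.
by rewrite -sumrB; apply: eq_bigr => i _; rewrite mulrBr.
Qed.

(** The series s and the expansion of g / d, with d a product of linear forms,
    both have product g with d, and d is injective on series in the region of
    the expansion.  The formula for the expansions is taken as a hypothesis so
    that the lemma serves for iota_12 with (a, b) = (0, 1) and for iota_21 with
    (a, b) = (1, 0). *)
Lemma expansion_unique (a b : int) (ex : F * F -> int * int -> F) g ps s :
  a != b ->
  (forall p, bounded_below a b (ex p)) ->
  (forall g ps, all (fun p => p != 0) ps ->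
     iota_series ex (tofrac g / tofrac (\prod_(p <- ps) linform p)) =
     fmul (polyser g) (denexp ex ps)) ->
  all (fun p => p != 0) ps -> bounded_below a b s ->
  fmul (polyser (\prod_(p <- ps) linform p)) s = polyser g ->
  s = iota_series ex (tofrac g / tofrac (\prod_(p <- ps) linform p)).
Proof.
move=> ab bex exE ps0 bs sg; rewrite exE//; set d := \prod_(p <- ps) _ in sg *.
(* the expansion formula for the two fractions d / d and 1 / 1 *)
have den1 : fmul (polyser d) (denexp ex ps) = @fone F _.
  have d0 : d != 0.
    rewrite /d prodf_seq_neq0; apply/allP => p /(allP ps0) p0 /=.
    apply: contra_neq p0 => l0; have [l2 l1] := linform_coef p.
    by move: l1 l2; rewrite l0 !coef0; case: (p) => ? ? /= <- <-.
  rewrite -exE// divff ?tofrac_eq0// -[1]divr1 -tofrac1.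
  have {2}-> : 1 = \prod_(p <- [::]) linform (F := F) p by rewrite big_nil.
  by rewrite exE//=; apply/funext => e; rewrite polyser_act1.
apply/funext => e; apply/eqP; rewrite -subr_eq0; apply/eqP; move: e.
set t := fmul _ (denexp _ _); pose u e := s e - t e.
suff u0 : u = (fun=> 0) by move=> e; rewrite -[LHS]/(u e) u0.
apply: (linforms_act_inj (ps := ps) ab) => //.
  apply: bounded_belowB => //; apply: bounded_belowM.
    exact: bounded_below_polyser.
  exact: bounded_below_denexp.
rewrite polyser_actB sg /t -polyser_actM mulrC polyser_actM den1 fmulr1.
by apply/funext => e; rewrite subrr.
Qed.

(** * Binomial series and Laurent polynomials *)

Lemma binz_nat (k i : nat) : [pchar F] =i pred0 ->
  binz F k%:Z i = 'C(k, i)%:R.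
Proof.
move=> char0; have fact0 : i`!%:R != 0 :> F by rewrite (pcharf0P F).1// -lt0n fact_gt0.
apply: (mulIf fact0); rewrite /binz divfK// -natrM bin_ffact {char0 fact0}.
elim: i => [|i IH]; first by rewrite big_ord0 ffactn0.
rewrite big_ord_recr /= IH ffactnSr natrM.
have [ik|ki] := leqP i k; first by rewrite natrB.
by rewrite ffact_small// !mul0r.
Qed.

(** Weak cocommutativity is stated with the binomial series of exponent k;
    for k >= 0 that series is a polynomial, so the algebra of polynomial actions
    applies to it.  Characteristic 0 makes the factorials in the binomial
    coefficients invertible. *)
Lemma binexp_nat (k : nat) : [pchar F] =i pred0 ->
  binexp F k%:Z = polyser ((X1 F - X2 F) ^+ k).
Proof.
move=> char0; apply/funext => -[m [j|j]]; last by case: m.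
have term (l : 'I_k.+1) i : (((-1) ^+ l * 'X%:P ^+ (k - l) * 'X ^+ l *+ 'C(k, l)
    : {poly {poly F}})`_j)`_i =
    (-1) ^+ l * 'C(k, l)%:R * ((i == k - l)%N && (j == l))%:R :> F.
  have -> : (-1) ^+ l * 'X%:P ^+ (k - l) * 'X ^+ l *+ 'C(k, l) =
      (((-1) ^+ l * 'C(k, l)%:R) *: 'X ^+ (k - l))%:P * 'X ^+ l :> {poly {poly F}}.
    rewrite -mul_polyC !polyCM !polyC_exp polyCN polyCMn !polyC1 -mulr_natr.
    by rewrite !polyCN polyC1 !polyCMn polyC1; ring.
  rewrite coefCM coefXn; case: eqP => _; last by rewrite mulr0 coef0 andbF mulr0.
  by rewrite mulr1 andbT coefZ coefXn.
have coefE i : (((X1 F - X2 F) ^+ k)`_j)`_i =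
    if (i + j == k)%N then (-1) ^+ j * 'C(k, j)%:R else 0.
  rewrite exprBn !coef_sum; under eq_bigr do rewrite term.
  have [jk|kj] := leqP j k; last first.
    rewrite big1; first by case: eqP => //; lia.
    move=> l _; rewrite (_ : (j == l) = false) ?andbF ?mulr0//.
    by have := ltn_ord l; lia.
  rewrite (bigD1 (Ordinal (jk : (j < k.+1)%N)))//= big1 ?addr0.
    by rewrite eqxx andbT (_ : (i == k - j)%N = (i + j == k)%N) ?mulr_natr; [case: eqP|lia].
  move=> l; rewrite -val_eqE /= => lj.
  by rewrite [j == l]eq_sym (negbTE lj) andbF mulr0.
rewrite /binexp /= binz_nat//; case: m => [i|i] /=.
  by rewrite coefE -PoszD eqz_nat.
by case: eqP => // ; have [jk|kj] := leqP j k; [lia | rewrite bin_small// mulr0].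
Qed.

Lemma laurent_finite_support s (A : nat) :
  (forall m n, s (m, n) != 0 -> - A%:Z <= m <= A%:Z /\ - A%:Z <= n <= A%:Z) ->
  exists g, fmul (polyser (X1 F ^+ A * X2 F ^+ A)) s = polyser g.
Proof.
move=> sA; pose c (i j : nat) := s (i%:Z - A%:Z, j%:Z - A%:Z).
exists (\poly_(j < (2 * A).+1) \poly_(i < (2 * A).+1) c i j).
have shift1 (k : nat) t m n :
    fmul (polyser (X1 F ^+ k)) t (m, n) = t (m - k%:Z, n).
  elim: k m n => [|k IH] m n; first by rewrite polyser_act1 subr0.
  by rewrite exprSr polyser_actX1 IH /= intS opprD addrA.
have shift2 (k : nat) t m n :
    fmul (polyser (X2 F ^+ k)) t (m, n) = t (m, n - k%:Z).
  elim: k m n => [|k IH] m n; first by rewrite polyser_act1 subr0.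
  by rewrite exprSr polyser_actX2 IH /= intS opprD addrA.
apply/funext => -[m n]; rewrite polyser_actM shift1 shift2.
have [sn0|/sA sn0] := eqVneq (s (m - A%:Z, n - A%:Z)) 0.
  rewrite sn0; case: m n sn0 => [i|i] [j|j] //= sn0.
  rewrite coef_poly; case: ifP; rewrite ?coef0// coef_poly.
  by case: ifP; rewrite ?coef0// /c sn0.
case: m n sn0 => [i|i] [j|j] /= sn0; try lia.
have [iA jA] : (i < (2 * A).+1)%N /\ (j < (2 * A).+1)%N by lia.
by rewrite coef_poly jA coef_poly iA.
Qed.

End SeriesSupport.

(** * Weights of the iterated coactions *)

Section GradedTensors.
Variables (F : fieldType) (J : pzRingType) (V M : lmodType F).
Variables (gV : int -> set V) (gM : J -> set M).

Lemma tgrading_pure (i : int) (j : J) v w :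
  gV i v -> gM j w -> tgrading gV gM (i%:~R + j) (tpure v w).
Proof.
move=> vi wj; exists [:: (v, w)]; split; last by rewrite big_seq1.
by move=> p; rewrite inE => /eqP ->; exists i, j.
Qed.

Lemma tgrading_sum (I : eqType) (r : seq I) (k : J) (f : I -> V ⊗ M) :
  (forall i, i \in r -> tgrading gV gM k (f i)) ->
  tgrading gV gM k (\sum_(i <- r) f i).
Proof.
move=> fk; rewrite big_seq; elim/big_ind: _ => [|_ _ [s [sk ->]] [t [tk ->]]|//].
  by exists [::]; rewrite big_nil.
exists (s ++ t); rewrite big_cat; split=> // p.
by rewrite mem_cat => /orP[/sk|/tk].
Qed.

End GradedTensors.

Section IteratedCoaction.
Variables (F : fieldType) (V M : lmodType F).
Variables (gV : int -> set V) (gM : rat -> set M).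
Variable Y : {linear M -> (int -> V ⊗ M)}.
Hypothesis Ygr : graded_coaction Y gV gM.

Lemma ycoef_graded (j : rat) w n : gM j w ->
  tgrading gV gM (j - n%:~R) (ycoef Y n w).
Proof.
move=> /Ygr/(_ (- n - 1)); rewrite /ydelta /ycoef.
have -> : - (- n - 1) - 1 = n :> int by ring.
by rewrite rmorphB rmorphN rmorph1 addrA subrK.
Qed.

Lemma yy12_graded (j : rat) w (m n : int) : gM j w ->
  tgrading gV (tgrading gV gM) (j - (m + n)%:~R) (yy12 Y w (m, n)).
Proof.
move=> /ycoef_graded - /(_ m) [s [sm sE]]; rewrite /yy12 -/(ycoef Y m w) sE.
rewrite linear_sum; apply: tgrading_sum => p /sm [i [l [pi pl il]]].
rewrite tmapE; have -> : j - (m + n)%:~R = i%:~R + (l - n%:~R) :> rat.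
  by rewrite rmorphD opprD addrA -il addrA.
by apply: tgrading_pure => //; apply: ycoef_graded.
Qed.

(** Up to the transposition of the first two tensor factors, which preserves
    weights, this is the other iterate with the exponents exchanged. *)
Lemma yy21_graded (j : rat) w (m n : int) : gM j w ->
  tgrading gV (tgrading gV gM) (j - (m + n)%:~R) (yy21 Y w (m, n)).
Proof.
move=> wj; have := @yy12_graded j w n m wj; rewrite [n + m]addrC.
move=> [s [sm sE]]; rewrite [yy21 _ _ _](congr1 (tswap12 V V M) sE) linear_sum.
apply: tgrading_sum => -[v _] /sm [i [l [/= vi [t [tl ->]] <-]]].
rewrite linear_sumr linear_sum; apply: tgrading_sum => -[v2 x].
move=> /tl[i' [l' [/= vi' xl' <-]]]; rewrite tswap12E addrCA.
by do 2!apply: tgrading_pure => //.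
Qed.

Hypotheses (gM_grading : is_grading gM) (Ytr : truncated Y).
Variable v' : gdual (tgrading gV (tgrading gV gM)).

(** For w of weight j only finitely many weights j - (m + n) are seen by v',
    which bounds m + n; a general w is a finite sum of homogeneous vectors.  The
    map z stands for either of the two iterated coactions. *)
Lemma pairing_bounded (z : {linear M -> (int * int -> V ⊗ (V ⊗ M))}) w :
  (forall j w m n, gM j w ->
     tgrading gV (tgrading gV gM) (j - (m + n)%:~R) (z w (m, n))) ->
  bounded_below 1 1 (pairing v' (z w)).
Proof.
move=> zgr; have [f [[fj _ ->] _]] := grading_dec gM_grading w.
apply: (big_ind (fun w => bounded_below 1 1 (pairing v' (z w)))).
- by exists 0 => m n _; rewrite /pairing linear0 [LHS]linear0.
- move=> w1 w2 [N1 z1] [N2 z2]; exists (Num.min N1 N2) => m n.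
  rewrite lt_min /pairing linearD => /andP[/z1 e1 /z2 e2].
  by rewrite [LHS]linearD; move: e1 e2; rewrite /pairing => -> ->; rewrite addr0.
move=> j _; have [r r0] := gdual_fin v'.
pose B : rat := \sum_(l <- r) `|j - l|.
exists (- (Num.bound B)%:Z) => m n mnB; apply: (r0 (j - (m + n)%:~R)); last exact: zgr.
apply/negP => lr; move: mnB; rewrite !mul1r ltNge => /negP[].
rewrite lerNl -(ler_int rat) rmorphN /=.
have le : - (m + n)%:~R <= B :> rat.
  apply: le_trans (_ : `|j - (j - (m + n)%:~R)| <= _); last first.
    by rewrite /B (big_rem _ lr) lerDl sumr_ge0.
  by rewrite subKr -normrN ler_norm.
apply: le_trans le _; apply/ltW/archi_boundP; exact: sumr_ge0.
Qed.

Lemma pairing_yy12_bounded w : bounded_below 1 1 (pairing v' (yy12 Y w)).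
Proof.
have z_lin : linear (yy12 Y).
  by move=> a x y; apply/funext => e; rewrite /yy12 -!/(ycoef Y _ _) !linearP.
pose z : {linear _ -> _} := HB.pack (yy12 Y) (GRing.isLinear.Build F _ _ _ _ z_lin).
by apply: (@pairing_bounded z) => j {}w m n; apply: yy12_graded.
Qed.

Lemma pairing_yy21_bounded w : bounded_below 1 1 (pairing v' (yy21 Y w)).
Proof.
have z_lin : linear (yy21 Y).
  by move=> a x y; apply/funext => e; rewrite /yy21 -!/(ycoef Y _ _) !linearP.
pose z : {linear _ -> _} := HB.pack (yy21 Y) (GRing.isLinear.Build F _ _ _ _ z_lin).
by apply: (@pairing_bounded z) => j {}w m n; apply: yy21_graded.
Qed.

Lemma pairing_yy12_truncated w : bounded_below (- 1) 0 (pairing v' (yy12 Y w)).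
Proof.
have [N Y0] := Ytr w; exists (- N) => m n mN; rewrite /pairing /yy12 /=.
by rewrite Y0 ?linear0 1?[LHS]linear0//; lia.
Qed.

Lemma pairing_yy21_truncated w : bounded_below 0 (- 1) (pairing v' (yy21 Y w)).
Proof.
have [N Y0] := Ytr w; exists (- N) => m n mN; rewrite /pairing /yy21 /=.
by rewrite Y0 ?linear0 1?[LHS]linear0//; lia.
Qed.

End IteratedCoaction.

(** * The common rational function *)

(** The hypotheses on the supports of s and u are complementary: the product with
    (x1 - x2)^k inherits both pairs, and the region m <= N1, n <= N2,
    m + n >= N3 is finite. *)
Lemma common_rational_function (F : fieldType) (s u : int * int -> F) (k : nat) :
  bounded_below (- 1) 0 s -> bounded_below 1 1 s ->
  bounded_below 0 (- 1) u -> bounded_below 1 1 u ->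
  fmul (polyser ((X1 F - X2 F) ^+ k)) s = fmul (polyser ((X1 F - X2 F) ^+ k)) u ->
  exists (g : {poly {poly F}}) (A : nat),
  let f := tofrac g / (tofrac (X1 F) ^ A%:Z * tofrac (X2 F) ^ A%:Z
                    * tofrac (X1 F - X2 F) ^ k%:Z) in
  [/\ ratS f, s = iota12 f & u = iota21 f].
Proof.
move=> s1 s2 u1 u2 su; set q := polyser _ in su; pose P := fmul q s.
have bq a b : bounded_below a b q by apply: bounded_below_polyser.
have [N1 P1] : bounded_below (- 1) 0 P by apply: bounded_belowM.
have [N2 P2] : bounded_below 0 (- 1) P by rewrite /P su; apply: bounded_belowM.
have [N3 P3] : bounded_below 1 1 P by apply: bounded_belowM.
pose A := (`|N1| + `|N2| + `|N3|)%N.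
have [g gP] : exists g, fmul (polyser (X1 F ^+ A * X2 F ^+ A)) P = polyser g.
  apply: laurent_finite_support => m n Pmn.
  have := contra_neqN (P1 m n) Pmn; have := contra_neqN (P2 m n) Pmn.
  by have := contra_neqN (P3 m n) Pmn; rewrite /A; lia.
(* (1, 0), (0, 1) and (1, -1) are the linear forms x1, x2 and x1 - x2 *)
exists g, A; pose ps : seq (F * F) := nseq A (1, 0) ++ nseq A (0, 1) ++ nseq k (1, - 1).
have ps0 : all (fun p => p != 0) ps.
  rewrite !all_cat !all_nseq -!pair_eqE /= /pair_eq /= !oner_eq0 /= !orbT.
  by rewrite andbF !orbT.
have dE : \prod_(p <- ps) linform p = X1 F ^+ A * X2 F ^+ A * (X1 F - X2 F) ^+ k.
  rewrite !big_cat !big_nseq /= !iter_mulr_1 mulrA /linform /=.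
  by rewrite !polyCN !polyC1 !polyC0 !mul1r !mul0r addr0 add0r mulN1r.
have -> : tofrac (X1 F) ^ A%:Z * tofrac (X2 F) ^ A%:Z * tofrac (X1 F - X2 F) ^ k%:Z
    = tofrac (\prod_(p <- ps) linform p) by rewrite dE !tofracM !tofracXn.
move=> f; split; first by exists g, ps.
- apply: (@expansion_unique _ 0 1) => //.
  + exact: bounded_below_linexp12.
  + exact: iota12E.
  + (* n = (m + n) - m is bounded from below *)
    case: s1 s2 => [L s1] [L' s2]; exists (L + L') => m n mn.
    have [/s1//|mL] := ltP (- 1 * m + 0 * n) L; apply: s2; lia.
  + by rewrite dE polyser_actM.
- apply: (@expansion_unique _ 1 0) => //.
  + exact: bounded_below_linexp21.
  + exact: iota21E.
  + case: u1 u2 => [L u1] [L' u2]; exists (L + L') => m n mn.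
    have [/u1//|mL] := ltP (0 * m + - 1 * n) L; apply: u2; lia.
  + by rewrite dE polyser_actM -[fmul (polyser (_ ^+ k)) u]su.
Qed.

Theorem proposition4p4 (F : fieldType) (charF : [pchar F] =i pred0)
    (V : lmodType F) (gV : int -> set V)
    (YV : {linear V -> (int -> V ⊗ V)}) (c : {scalar V})
    (hV : graded_vertex_coalgebra YV c gV)
    (M : lmodType F) (gM : rat -> set M)
    (YM : {linear M -> (int -> V ⊗ M)})
    (hM : comodule_except_jacobi gV c gM YM)
    (hcocom : weak_cocommutativity gV gM YM)
    (v' : gdual (tgrading gV (tgrading gV gM))) (w : M) :
  [/\ right_series (pairing v' (yy12 YM w)),
      exists f : {fraction {poly {poly F}}},
        [/\ ratS f,
            pairing v' (yy12 YM w) = iota12 f,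
            forall f', ratS f' -> pairing v' (yy12 YM w) = iota12 f' -> f' = f &
            exists (g : {poly {poly F}}) (r s t : int),
              f = tofrac g / (tofrac (X1 F) ^ r * tofrac (X2 F) ^ s
                              * tofrac (X1 F - X2 F) ^ t)] &
      [/\ (@iota12 F @` @ratS F) (pairing v' (yy12 YM w)),
          (@iota21 F @` @ratS F) (pairing v' (yy21 YM w)) &
          iota12_inv (pairing v' (yy12 YM w)) =
          iota21_inv (pairing v' (yy21 YM w))]].
Proof.
case: hM => gM_grading _ Ygr _ Ytr.
have s1 := pairing_yy12_truncated Ytr v' w.
have s2 := pairing_yy12_bounded Ygr gM_grading v' w.
have u1 := pairing_yy21_truncated Ytr v' w.
have u2 := pairing_yy21_bounded Ygr gM_grading v' w.
have [k [_ comm]] := hcocom v'.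
have su : fmul (polyser ((X1 F - X2 F) ^+ k)) (pairing v' (yy12 YM w)) =
          fmul (polyser ((X1 F - X2 F) ^+ k)) (pairing v' (yy21 YM w)).
  apply/funext => e; apply/eqP; rewrite -subr_eq0; apply/eqP.
  rewrite -[RHS](comm w e) binexp_nat//.
  rewrite -[LHS](congr1 (fun t => t e) (polyser_actB _ _ _)).
  by congr (fmul _ _ _); apply/funext => i; rewrite /pairing linearB.
have [g [A [fS sE uE]]] := common_rational_function s1 s2 u1 u2 su.
set f := (X in ratS X) in fS sE uE.
split.
- case: s1 s2 => [L s1] [L' s2]; exists (`|L| + `|L'|) => m n mn.
  have [/s1//|mL] := ltP (- 1 * m + 0 * n) L; apply: s2; lia.
- exists f; split=> // [f' f'S e|]; last by exists g, A%:Z, A%:Z, k%:Z.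
  by apply: iota12_inj => //; rewrite -e sE.
split; [by exists f|by exists f|].
have -> : iota12_inv (pairing v' (yy12 YM w)) = f.
  apply: xget_unique => // f' [f'S e].
  by apply: iota12_inj => //; rewrite e sE.
apply/esym/xget_unique => // f' [f'S e].
by apply: iota21_inj => //; rewrite e uE.
Qed.
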